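(* Let $q$ be a prime power with $q\equiv 1 \pmod 4$, $3\mid (q-1)$ and $q>2809$, and let $n=1+\frac{q-1}{3}$. Then there exists an element of $\mathbb{F}_q$ that cannot be written as $\alpha+\beta$ with $\alpha\in C_5$ and $\beta\in C_n$.
   Context: For a prime power $q$ and an integer $k>1$, an element $a\in\mathbb{F}_q$ is called a $k$-potent if $a^k=a$, and $C_k$ denotes the set of all $k$-potents in $\mathbb{F}_q$. For $n=1+(q-1)/3$, $C_n$ is the set of cubes in $\mathbb{F}_q$, including $0$. *)

(* Defs.v *)
From mathcomp Require Import all_boot all_algebra.
Set Implicit Arguments. Unset Strict Implicit. Unset Printing Implicit Defensive.
Import GRing.Theory.
Local Open Scope ring_scope.

Definition kpotents (F : finFieldType) (k : nat) : {set F} :=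
  [set a : F | a ^+ k == a].

(* Main.v *)
Require Import Defs.
From mathcomp Require Import all_boot all_algebra.
From mathcomp Require Import all_order all_field zify ring.

(** Suppose every element lies in [C_5 + C_n]. The Moebius maps permuting the octahedron
    {0, oo, 1, -1, i, -i} turn this assumption at the images of a point [x] into a
    condition on the cubic residue classes of the six linear forms vanishing at its
    vertices ([x] at 0, the constant [1] at oo, and [2 (x - t)] at [t] with [t^4 = 1],
    where the factor 2 makes the conditions symmetric): the value at each vertex agrees,
    up to cubes, with that at its antipode, or with that at some neighbour after
    multiplication by a fixed power of 2. A finite check on the colourings of the
    octahedron by Z/3 shows that such colourings satisfy a linear inequality between the
    number of equal pairs, the number of triples (vertex, antipode, neighbour) of sum 0,
    and the class of [x (x^4 - 1)], which fails on average over random colourings.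
    Summing over [x] only involves cubic character sums with at most three linear factors
    and the sum of [x (x^4 - 1)]. These are O(sqrt q) without the Weil bound: the family
    [d x (x^r - a)] is, up to rescaling [x], constant on large sets of pairs [(d, a)], so
    each member is controlled by the second moment over the family. *)

Set Implicit Arguments. Unset Strict Implicit. Unset Printing Implicit Defensive.
Import Order.TTheory GRing.Theory Num.Theory.
Local Open Scope ring_scope.

(** * Colourings of the octahedron *)

Fixpoint words n : seq (seq nat) :=
  if n is n'.+1 then [seq c :: v | c <- iota 0 3, v <- words n'] else [:: [::]].

Lemma mem_words (v : seq nat) : all (fun c => c < 3)%N v -> v \in words (size v).
Proof.
elim: v => [|c v IHv] //= /andP[c3 v3].
rewrite cats0 !mem_cat.
have mapc : c :: v \in [seq c :: v0 | v0 <- words (size v)] by rewrite map_f ?IHv.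
by case: c c3 mapc => [|[|[|//]]] _ ->; rewrite ?orbT.
Qed.

(* The vertices 0, oo, 1, -1, i, -i are numbered 0, ..., 5 in this order. *)
Definition antip : seq (nat * nat) := [:: (0, 1); (2, 3); (4, 5)]%N.

(** [P./2] numbers the antipodal pair of [P], so these are the 12 edges of the octahedron, each
    listed once. *)
Definition edges : seq (nat * nat) :=
  [seq PQ <- [seq (P, Q) | P <- iota 0 6, Q <- iota 0 6] | (PQ.1./2 < PQ.2./2)%N].

Definition fans : seq (nat * nat * nat) :=
  [seq (PP, Q) | PP <- antip, Q <- [seq Q <- iota 0 6 | Q./2 != PP.1./2]].

Definition antipode (P : nat) : nat := if odd P then P.-1 else P.+1.

(** The coefficient 2 stands for -1 modulo 3 and matches the exponent in [kappa (u * v ^+ 2)]. *)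
Definition monochrome (w : seq nat) (PQ : nat * nat) : bool :=
  (3 %| nth 0 w PQ.1 + 2 * nth 0 w PQ.2)%N.

Definition null_fan (w : seq nat) (T : nat * nat * nat) : bool :=
  (3 %| nth 0 w T.1.1 + nth 0 w T.1.2 + nth 0 w T.2)%N.

(* [D] is the colour of 2; a factor 1/2, or equally 4, has colour [2 * D] mod 3. *)
Definition matched (D : nat) (w : seq nat) (P : nat) : bool :=
  monochrome w (antipode P, P) ||
  has (fun Q => (Q./2 != P./2) && (3 %| nth 0 w Q + 2 * nth 0 w P + 2 * D)%N) (iota 0 6).

(** Exhaustion over the 729 colourings. For random colours the right side averages 4 + 1 + 4/3,
    which is less than 7; this gap gives the contradiction when 2 is a cube. *)
Lemma matched0 (w : seq nat) : size w = 6%N -> all (fun c => c < 3)%N w ->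
  all (matched 0 w) (iota 0 6) ->
  (7 <= count (monochrome w) edges + count (monochrome w) antip + 4 * (3 %| sumn w))%N.
Proof.
move=> sz w3 mw.
have /allP chk : all (fun w => all (matched 0 w) (iota 0 6) ==>
  (7 <= count (monochrome w) edges + count (monochrome w) antip
        + 4 * (3 %| sumn w))%N) (words 6) by vm_compute.
by apply: implyP mw; apply: chk; rewrite -sz mem_words.
Qed.

(** For random colours the left side averages 7 and the right side 6. The shift in [sumn w + 2]
    makes it the colour of x (x^4 - 1) when 2 has colour 1. *)
Lemma matched1 (w : seq nat) : size w = 6%N -> all (fun c => c < 3)%N w ->
  all (matched 1 w) (iota 0 6) ->
  (3 + count (monochrome w) edges <= count (monochrome w) antip
     + count (null_fan w) fans + 3 * (3 %| sumn w + 2))%N.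
Proof.
move=> sz w3 mw.
have /allP chk : all (fun w => all (matched 1 w) (iota 0 6) ==>
  (3 + count (monochrome w) edges <= count (monochrome w) antip
     + count (null_fan w) fans + 3 * (3 %| sumn w + 2))%N) (words 6) by vm_compute.
by apply: implyP mw; apply: chk; rewrite -sz mem_words.
Qed.

(** * The cubic residue symbol *)

Lemma cube_root1 (K : fieldType) (w u : K) :
  w ^+ 3 = 1 -> w != 1 -> u ^+ 3 = 1 -> [|| u == 1, u == w | u == w ^+ 2].
Proof.
move=> w3 w1 u3.
have h : w ^+ 2 + w + 1 = 0.
  have : (w - 1) * (w ^+ 2 + w + 1) = w ^+ 3 - 1 by ring.
  by rewrite w3 subrr => /eqP; rewrite mulf_eq0 subr_eq0 (negPf w1) => /eqP.
have : (u - 1) * ((u - w) * (u - w ^+ 2)) =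
  u ^+ 3 - w ^+ 3 - (w ^+ 2 + w + 1) * u ^+ 2 + (w ^+ 3 - 1 + (w ^+ 2 + w + 1)) * u.
  by ring.
rewrite u3 w3 h subrr !mul0r subr0 add0r addr0 mul0r.
by move/eqP; rewrite !mulf_eq0 !subr_eq0.
Qed.

(** X^m - 1 has at most m roots, too few to cover all nonzero elements. *)
Lemma exists_expf_neq1 (K : finFieldType) (m : nat) :
  (0 < m)%N -> (m < #|K|.-1)%N -> exists2 g : K, g != 0 & g ^+ m != 1.
Proof.
move=> m0 lt; have p0 : ('X^m - 1%:P : {poly K}) != 0.
  by rewrite -size_poly_gt0 size_XnsubC.
case: (boolP [exists g : K, (g != 0) && (g ^+ m != 1)]).
  by case/existsP => g /andP[]; exists g.
rewrite negb_exists => /forallP h.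
have := @max_poly_roots _ _ (enum (predC1 (0 : K))) p0.
rewrite enum_uniq size_XnsubC // -cardE cardC1 ltnS leqNgt lt => H.
suff /H/(_ isT) : all (root ('X^m - 1%:P)) (enum (predC1 (0 : K))) by [].
apply/allP => x; rewrite mem_enum inE /= => x0.
by move: (h x); rewrite x0 /= negbK /root !hornerE subr_eq0.
Qed.

Section CubicResidues.

Variable F : finFieldType.
Hypothesis q3 : (3 %| #|F|.-1)%N.

Definition cubesym (x : F) : F := x ^+ (#|F|.-1 %/ 3).

(** This is chi + chi^2 for a cubic character chi, so all sums stay in the integers. The cubes, 0
    included, are exactly the points where it differs from -1. *)
Definition kappa (x : F) : int :=
  if x == 0 then 0 else if cubesym x == 1 then 2 else -1.

Lemma expf_pred (x : F) : x != 0 -> x ^+ #|F|.-1 = 1.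
Proof.
move=> x0; apply: (mulfI x0); rewrite -exprS mulr1 prednK ?expf_card //.
by apply/card_gt0P; exists 0.
Qed.

Lemma cubesymM (x y : F) : cubesym (x * y) = cubesym x * cubesym y.
Proof. exact: exprMn. Qed.

Lemma cubesymX (x : F) k : cubesym (x ^+ k) = cubesym x ^+ k.
Proof. by rewrite /cubesym exprAC. Qed.

Lemma cubesym_cube (x : F) : x != 0 -> cubesym x ^+ 3 = 1.
Proof. by move=> x0; rewrite -exprM divnK // expf_pred. Qed.

Lemma kappa0 : kappa 0 = 0.
Proof. by rewrite /kappa eqxx. Qed.

Lemma kappa_cube (x : F) : x != 0 -> cubesym x = 1 -> kappa x = 2.
Proof. by rewrite /kappa => /negPf-> ->; rewrite eqxx. Qed.

Lemma kappa_le (x : F) : -1 <= kappa x <= 2.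
Proof. by rewrite /kappa; case: ifP => // _; case: ifP. Qed.

Lemma kappaMr (x y : F) : y != 0 -> cubesym y = 1 -> kappa (x * y) = kappa x.
Proof.
by move=> y0 y1; rewrite /kappa mulf_eq0 (negPf y0) orbF cubesymM y1 mulr1.
Qed.

Lemma kappaM3 (x y : F) : y != 0 -> kappa (x * y ^+ 3) = kappa x.
Proof. by move=> y0; rewrite kappaMr ?expf_neq0 // cubesymX cubesym_cube. Qed.

(** Reduces a comparison of cubic classes to a polynomial identity with explicit multipliers [u] and
    [v]. *)
Lemma kappa_cubic_eq (x y u v : F) : u != 0 -> v != 0 ->
  x * u ^+ 3 = y * v ^+ 3 -> kappa x = kappa y.
Proof. by move=> u0 v0 e; rewrite -(kappaM3 x u0) e kappaM3. Qed.

Lemma exists_noncube : (1 < #|F|)%N -> exists2 g : F, g != 0 & cubesym g != 1.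
Proof.
move=> q1; have m0 : (0 < #|F|.-1 %/ 3)%N by rewrite divn_gt0 // dvdn_leq //; lia.
by apply: exists_expf_neq1 => //; lia.
Qed.

(** For nonzero [x] the three arguments represent the three classes modulo cubes, so the values are
    2, -1, -1 in some order. *)
Lemma kappa_orbit (g x : F) : g != 0 -> cubesym g != 1 ->
  kappa x + kappa (x * g) + kappa (x * g ^+ 2) = 0.
Proof.
move=> g0 g1; rewrite /kappa !mulf_eq0 (negPf g0) !orbF.
case: ifP => // /negbT x0; rewrite !cubesymM -expr2.
set w := cubesym g; have w3 : w ^+ 3 = 1 := cubesym_cube g0.
have w2 : w ^+ 2 != 1 by apply: contra_neq g1 => e; rewrite -w3 exprS e mulr1.
have w4 : w ^+ 2 * w ^+ 2 = w ^+ 3 * w by ring.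
case/or3P: (cube_root1 w3 g1 (cubesym_cube x0)) => /eqP ->.
- by rewrite !mul1r eqxx (negPf g1) (negPf w2).
- by rewrite -expr2 -exprS w3 eqxx (negPf g1) (negPf w2).
- by rewrite -exprSr w4 w3 mul1r eqxx (negPf g1) (negPf w2).
Qed.

Hypothesis q1 : (1 < #|F|)%N.

Lemma sum_scale (c : F) (G : F -> int) : c != 0 -> \sum_x G (x * c) = \sum_x G x.
Proof. by move=> c0; rewrite [RHS](reindex_inj (mulIf c0)). Qed.

Lemma sum_kappa : \sum_x kappa x = 0.
Proof.
have [g g0 g1] := exists_noncube q1.
have : \sum_x (kappa x + kappa (x * g) + kappa (x * g ^+ 2)) = 0.
  by apply: big1 => x _; rewrite kappa_orbit.
rewrite !big_split /= (sum_scale kappa g0) (sum_scale kappa (expf_neq0 2 g0)).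
by move: (\sum_x _) => s; lia.
Qed.

Lemma sum_kappa_sqr : \sum_x kappa x ^+ 2 = 2 * (#|F|.-1)%:Z.
Proof.
have e (x : F) : kappa x ^+ 2 = kappa x + 2 * (x != 0)%:Z.
  by rewrite /kappa; case: ifP => // _; case: ifP.
rewrite (eq_bigr _ (fun x _ => e x)) big_split /= sum_kappa add0r -mulr_sumr.
congr (_ * _); rewrite -(cardC1 (0 : F)) -sum1_card [in RHS]big_mkcond /=.
rewrite (big_morph Posz PoszD (erefl _)).
by apply: eq_bigr => x _; rewrite !inE; case: eqP.
Qed.

Lemma kappa_orthogonal (u v : F) :
  \sum_d kappa (d * u) * kappa (d * v) = (#|F|.-1)%:Z * kappa (u / v).
Proof.
have [->|u0] := eqVneq u 0.
  by rewrite mul0r kappa0 mulr0 big1 // => d _; rewrite mulr0 kappa0 mul0r.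
have [->|v0] := eqVneq v 0.
  by rewrite invr0 mulr0 kappa0 mulr0 big1 // => d _; rewrite mulr0 kappa0 mulr0.
have t0 : u / v != 0 by rewrite mulf_neq0 ?invr_neq0.
have -> : \sum_d kappa (d * u) * kappa (d * v) = \sum_d kappa (d * (u / v)) * kappa d.
  rewrite -(sum_scale (fun d => kappa (d * (u / v)) * kappa d) v0).
  by apply: eq_bigr => d _; rewrite [u / v]mulrC mulrA mulfK.
move: (u / v) t0 => t t0; have [t1|t1] := eqVneq (cubesym t) 1.
  under eq_bigr => d _ do rewrite kappaMr // -expr2.
  by rewrite sum_kappa_sqr kappa_cube // mulrC.
(* Replacing [d] by [d * t] identifies the sums for [t] and [t ^+ 2]. The orbit relation then reads
   2 (q - 1) + 2 S = 0 for their common value S. *)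
have A2 : \sum_d kappa (d * t ^+ 2) * kappa d = \sum_d kappa (d * t) * kappa d.
  rewrite -(sum_scale (fun d => kappa (d * t ^+ 2) * kappa d) t0).
  by apply: eq_bigr => d _; rewrite -mulrA -exprS kappaM3 // mulrC.
have : \sum_d (kappa d + kappa (d * t) + kappa (d * t ^+ 2)) * kappa d = 0.
  by apply: big1 => d _; rewrite kappa_orbit // mul0r.
under eq_bigr => d _ do rewrite !mulrDl -expr2.
rewrite !big_split /= A2 sum_kappa_sqr [kappa t]/kappa (negPf t0) (negPf t1).
suff arith (s : int) : 2 * (#|F|.-1)%:Z + s + s = 0 -> s = (#|F|.-1)%:Z * -1.
  exact: arith.
lia.
Qed.

Lemma predF_gt0 : 0 < (#|F|.-1)%:Z.
Proof. by rewrite ltz_nat -subn1 subn_gt0. Qed.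

(* With 0^-1 = 0 the map x |-> a + b (x - c)^-1 is a bijection of the whole field. *)
Lemma sum_kappa_mobius (a b c : F) : b != 0 -> \sum_x kappa (a + b * (x - c)^-1) = 0.
Proof.
move=> b0; have h : injective (fun x => a + b * (x - c)^-1).
  by move=> x y /addrI/(mulfI b0)/invr_inj/addIr.
by rewrite -[RHS]sum_kappa [RHS](reindex_inj h).
Qed.

(** Away from the pole [c2] this Moebius function of [a] takes every value once except [l], its
    value at infinity; the full sum of [kappa] is 0. *)
Lemma sum_kappa_ratio (c1 c2 l : F) : c1 != c2 ->
  \sum_a kappa (l * ((c1 - a) / (c2 - a))) = - kappa l.
Proof.
move=> c12; have [->|l0] := eqVneq l 0.
  by rewrite kappa0 big1 // => a _; rewrite mul0r kappa0.
have b0 : l * (c2 - c1) != 0 by rewrite mulf_neq0 // subr_eq0 eq_sym.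
have := sum_kappa_mobius l c2 b0.
rewrite (bigD1 c2) //= subrr invr0 mulr0 addr0 => /eqP.
rewrite addr_eq0 -eqr_oppLR => /eqP ->.
rewrite (bigD1 c2) //= subrr invr0 !mulr0 kappa0 add0r.
apply: eq_bigr => a ac2; congr kappa.
have a0 : c2 - a != 0 by rewrite subr_eq0 eq_sym.
have a0' : a - c2 != 0 by rewrite subr_eq0.
by field; rewrite a0 a0'.
Qed.

Lemma card_roots (r : nat) (a : F) : (0 < r)%N -> (#|[pred t | t ^+ r == a]| <= r)%N.
Proof.
move=> r0; have p0 : ('X^r - a%:P : {poly F}) != 0 by rewrite -size_poly_gt0 size_XnsubC.
have := @max_poly_roots _ _ (enum [pred t | t ^+ r == a]) p0.
rewrite enum_uniq size_XnsubC // -cardE ltnS; apply=> //.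
by apply/allP => x; rewrite mem_enum inE /root !hornerE subr_eq0.
Qed.

Definition is_cube (x : F) : bool := (x != 0) && (cubesym x == 1).

Lemma card_cubes : (3 * #|is_cube|)%N = #|F|.-1.
Proof.
have e (x : F) : kappa x + (x != 0)%:Z = 3 * (is_cube x)%:Z.
  by rewrite /kappa /is_cube; case: ifP => // _; case: ifP.
have := sum_kappa; have -> : \sum_x kappa x =
    3 * \sum_x (is_cube x)%:Z - \sum_(x : F) (x != 0)%:Z.
  by rewrite mulr_sumr -sumrB; apply: eq_bigr => x _; rewrite -e addrK.
have cnt (A : pred F) : \sum_x (A x)%:Z = #|A|%:Z.
  rewrite -sum1_card (big_morph Posz PoszD (erefl _)) [RHS]big_mkcond /=.
  by apply: eq_bigr => x _; rewrite unfold_in; case: (A x).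
have c0 : #|(fun x : F => x != 0)| = #|F|.-1.
  by rewrite -(cardC1 (0 : F)); apply: eq_card => x; rewrite !inE.
rewrite (cnt (fun x => x != 0)) (cnt is_cube) c0.
suff arith (a b : nat) : 3 * a%:Z - b%:Z = 0 -> (3 * a)%N = b by exact: arith.
lia.
Qed.

(** * Second moments of the sums over d x (x^r - a) *)

Definition binsum (r : nat) (d a : F) : int := \sum_x kappa (d * (x * (x ^+ r - a))).

Lemma binsumMl (r : nat) (e d a : F) : e != 0 -> cubesym e = 1 ->
  binsum r (e * d) a = binsum r d a.
Proof.
move=> e0 e1; apply: eq_bigr => x _.
by rewrite -mulrA mulrC (kappaMr _ e0 e1).
Qed.

Lemma binsum_scale (r : nat) (d t : F) : t != 0 ->
  binsum r (d / t ^+ r.+1) (t ^+ r) = binsum r d 1.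
Proof.
move=> t0; rewrite /binsum.
rewrite -(sum_scale (fun x => kappa (_ * (x * (x ^+ r - t ^+ r)))) t0).
apply: eq_bigr => x _; congr kappa; rewrite exprMn exprSr.
by field; rewrite t0 expf_neq0.
Qed.

Lemma sum_binsum_sqr (r : nat) (a : F) :
  \sum_d binsum r d a ^+ 2 = (#|F|.-1)%:Z *
    \sum_y \sum_x kappa (x / y * ((x ^+ r - a) / (y ^+ r - a))).
Proof.
under eq_bigr => d _ do rewrite expr2 /binsum big_distrlr /=.
rewrite exchange_big /= mulr_sumr [RHS](eq_bigr _ (fun y _ => mulr_sumr _ _ _ _)).
rewrite [RHS]exchange_big; apply: eq_bigr => x _; rewrite exchange_big.
apply: eq_bigr => y _; rewrite kappa_orthogonal invfM.
by congr (_ * kappa _); ring.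
Qed.

(** For fixed x, y the sum over [a] is (q [x^r = y^r] - 1) [kappa (x / y)]. The part with -1 cancels
    on summing over x, and each nonzero y leaves at most r values of x, each contributing at most 2
    q. *)
Lemma sum_binsum_sqr_le (r : nat) : (0 < r)%N ->
  \sum_a \sum_d binsum r d a ^+ 2 <= 2 * r%:Z * #|F|%:Z * (#|F|.-1)%:Z ^+ 2.
Proof.
move=> r0; under eq_bigr => a _ do rewrite sum_binsum_sqr.
rewrite -mulr_sumr exchange_big /=.
have inner (x y : F) : \sum_a kappa (x / y * ((x ^+ r - a) / (y ^+ r - a))) =
    #|F|%:Z * ((x ^+ r == y ^+ r)%:Z * kappa (x / y)) - kappa (x / y).
  have [->|ne] := eqVneq (x ^+ r) (y ^+ r); last first.
    by rewrite sum_kappa_ratio // mul0r mulr0 add0r.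
  rewrite mul1r (bigD1 (y ^+ r)) //= subrr mul0r mulr0 kappa0 add0r.
  rewrite (eq_bigr (fun=> kappa (x / y))) => [|a ne]; last first.
    by rewrite divff ?mulr1 // subr_eq0 eq_sym.
  rewrite sumr_const (cardC1 (y ^+ r)) -mulr_natl -[X in _ - X]mul1r -mulrBl.
  congr (_ * _); rewrite natz.
  by suff arith (k : nat) : (1 < k)%N -> k.-1%:Z = k%:Z - 1; [exact: arith q1 | lia].
have inner_le (y : F) : \sum_a \sum_x kappa (x / y * ((x ^+ r - a) / (y ^+ r - a)))
    <= (y != 0)%:Z * (2 * r%:Z * #|F|%:Z).
  rewrite exchange_big /= (eq_bigr _ (fun x _ => inner x y)) sumrB -mulr_sumr.
  have [->|y0] := eqVneq y 0.
    by rewrite !big1 ?mulr0 // => x _; rewrite invr0 mulr0 kappa0 ?mulr0.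
  rewrite (sum_scale kappa (_ : y^-1 != 0)) ?invr_neq0 // sum_kappa subr0 mul1r.
  rewrite mulrC ler_pM2r; last by lia.
  apply: (@le_trans _ _ (\sum_x 2 * (x ^+ r == y ^+ r)%:Z)).
    apply: ler_sum => x _; have := kappa_le (x / y); case: eqP; lia.
  rewrite -mulr_sumr ler_pM2l // -[X in X <= _](@big_morph _ _ Posz _ _ _ _ PoszD (erefl _)).
  have := card_roots (y ^+ r) r0; rewrite -sum1_card big_mkcond lez_nat; apply: leq_trans.
  by rewrite leq_eqVlt; apply/orP; left; apply/eqP; apply: eq_bigr => x _; rewrite !inE; case: eqP.
rewrite expr2 mulrA [X in _ <= X]mulrC ler_pM2l; last exact: predF_gt0.
apply: le_trans (ler_sum _ (fun y _ => inner_le y)) _.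
rewrite -mulr_suml mulrC ler_pM2l ?mulr_gt0 ?ltz_nat ?(ltnW q1) //.
rewrite -(@big_morph _ _ Posz _ _ _ _ PoszD (erefl _)) -(cardC1 (0 : F)) -sum1_card.
rewrite [X in _ <= X%:Z]big_mkcond lez_nat leq_eqVlt; apply/orP; left; apply/eqP.
by apply: eq_bigr => x _; rewrite !inE; case: eqP.
Qed.

(* Up to scaling x, every t != 0 and every cube e turn the sum at (d, 1) into the sum at
   (e d / t^(r+1), t^r), and at most r values of t give the same t^r. *)
Lemma binsum_le (r : nat) (d : F) : (0 < r)%N ->
  binsum r d 1 ^+ 2 <= 6 * r%:Z ^+ 2 * #|F|%:Z.
Proof.
move=> r0; set m := #|is_cube|.
pose M (a : F) : int := \sum_d binsum r d a ^+ 2.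
have M0 a : 0 <= M a by apply: sumr_ge0 => x _; exact: sqr_ge0.
have mM (t : F) : t != 0 -> m%:Z * binsum r d 1 ^+ 2 <= M (t ^+ r).
  move=> t0; have [d0|d0] := eqVneq d 0.
    rewrite /binsum big1 ?expr0n ?mulr0 // => x _.
    by rewrite d0 mul0r kappa0.
  have d10 : d / t ^+ r.+1 != 0 by rewrite mulf_neq0 ?invr_neq0 ?expf_neq0.
  rewrite /M -(sum_scale (fun e => binsum r e _ ^+ 2) d10).
  rewrite (bigID is_cube) /=.
  rewrite (eq_bigr (fun=> binsum r d 1 ^+ 2)) => [|e /andP[e0 /eqP e1]]; last first.
    by rewrite binsumMl // binsum_scale.
  rewrite sumr_const -mulr_natl natz lerDl.
  by apply: sumr_ge0 => x _; exact: sqr_ge0.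
have step1 : (#|F|.-1)%:Z * (m%:Z * binsum r d 1 ^+ 2) <= \sum_(t | t != 0) M (t ^+ r).
  rewrite -natz mulr_natl -(cardC1 (0 : F)) -sumr_const.
  by apply: ler_sum => t; rewrite inE; exact: mM.
have step2 : \sum_(t | t != 0) M (t ^+ r) <= r%:Z * \sum_a M a.
  apply: (@le_trans _ _ (\sum_t M (t ^+ r))).
    by rewrite [X in _ <= X](bigID (fun t : F => t != 0)) /= lerDl sumr_ge0.
  rewrite (partition_big (fun t => t ^+ r) predT) //= mulr_sumr.
  apply: ler_sum => a _; rewrite (eq_bigr (fun=> M a)) => [|t /eqP-> //].
  rewrite sumr_const -mulr_natl natz ler_wpM2r // lez_nat.
  exact: card_roots.
have step3 := sum_binsum_sqr_le r0; rewrite -/M in step3.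
have q0 := predF_gt0.
rewrite -(ler_pM2l (exprn_gt0 2 q0)).
(* Since m is (q - 1) / 3, dividing the total 2 r q (q - 1)^2 by (q - 1) m / r members gives the
   constant 6 r^2 q. *)
have m3 : (#|F|.-1)%:Z = 3 * m%:Z by rewrite -PoszM card_cubes.
have -> : (#|F|.-1)%:Z ^+ 2 * binsum r d 1 ^+ 2 =
    3 * ((#|F|.-1)%:Z * (m%:Z * binsum r d 1 ^+ 2)) by rewrite expr2 {2}m3; ring.
apply: (@le_trans _ _ (3 * (r%:Z * \sum_a M a))).
  by rewrite ler_pM2l //; exact: le_trans step1 step2.
apply: (@le_trans _ _ (3 * (r%:Z * (2 * r%:Z * #|F|%:Z * (#|F|.-1)%:Z ^+ 2)))).
  by rewrite ler_pM2l // ler_wpM2l.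
by rewrite le_eqVlt; apply/orP; left; apply/eqP; ring.
Qed.

(** * Sums over products of linear forms *)

Definition lin (p : F * F) (x : F) : F := p.1 * x + p.2.

(** The determinant of two forms: nonzero exactly when they are independent, that is, vanish at
    distinct points of the projective line. *)
Definition wedge (p r : F * F) : F := p.1 * r.2 - p.2 * r.1.

Lemma sum_kappa_affine (a b : F) : a != 0 -> \sum_x kappa (a * x + b) = 0.
Proof.
move=> a0; have h : injective (fun x => a * x + b) by move=> x y /addIr/(mulfI a0).
by rewrite -[RHS]sum_kappa [RHS](reindex_inj h).
Qed.

(** Up to the cube of the second form the argument is the quotient of the forms, a Moebius function
    of x. Over the finite points its sum misses only the value at infinity, which costs at most
    2. *)
Lemma sum_kappa_pair (p r : F * F) : wedge p r != 0 ->
  `|\sum_x kappa (lin p x * lin r x ^+ 2)| <= 2.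
Proof.
case: p r => [a b] [c d]; rewrite /wedge /lin /= => det0.
have [c0|c0] := eqVneq c 0.
  move: det0; rewrite c0 mulr0 subr0 mulf_eq0 => /norP[a0 d0].
  rewrite (eq_bigr (fun x => kappa (a * d ^+ 2 * x + b * d ^+ 2))) => [|x _]; last first.
    by congr kappa; ring.
  by rewrite sum_kappa_affine // mulf_neq0 // expf_neq0.
have e0 : (b * c - a * d) / c ^+ 2 != 0.
  by rewrite mulf_neq0 ?invr_neq0 ?expf_neq0 // -oppr_eq0 opprB.
have := sum_kappa_mobius (a / c) (- d / c) e0.
rewrite (bigD1 (- d / c)) //= subrr invr0 mulr0 addr0.
rewrite [\sum_x kappa _](bigD1 (- d / c)) //= (_ : c * (- d / c) + d = 0); last by field.
rewrite expr0n mulr0 kappa0 add0r => E.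
rewrite (eq_bigr (fun x => kappa (a / c + (b * c - a * d) / c ^+ 2 / (x - - d / c))))
  => [|x xc]; last first.
  have x0 : c * x + d != 0.
    apply: contra_neq xc => h; apply: (mulfI c0); rewrite -[c * x](addrK d) h.
    by field.
  rewrite -[RHS](kappaM3 _ x0); congr kappa.
  by field; rewrite c0 /= opprK mulrC x0.
have := kappa_le (a / c).
suff arith (s k : int) : k + s = 0 -> -1 <= k <= 2 -> `|s| <= 2 by exact: arith.
lia.
Qed.

(** The affine substitution x = k y - b/a moves the two roots to y = 0 and y = 1, which yields a sum
    [binsum 1]. *)
Lemma sum_kappa_two (B : int) (s : F) (p r : F * F) :
    (forall d, `|binsum 1 d 1| <= B) -> p.1 != 0 -> r.1 != 0 -> wedge p r != 0 ->
  `|\sum_x kappa (s * (lin p x * lin r x))| <= B.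
Proof.
move=> hB; case: p r => [a b] [c d]; rewrite /wedge /lin /= => a0 c0 det0.
set k := b / a - d / c; have k0 : k != 0.
  have -> : k = - (a * d - b * c) / (a * c) by rewrite /k; field; rewrite a0 c0.
  by rewrite mulf_neq0 ?oppr_eq0 // invr_neq0 // mulf_neq0.
have h : injective (fun y => k * y - b / a) by move=> x y /addIr/(mulfI k0).
rewrite (reindex_inj h) /=; apply: le_trans (hB (s * a * c * k ^+ 2)).
rewrite le_eqVlt; apply/orP; left; apply/eqP; congr `|_|.
apply: eq_bigr => x _; congr kappa; rewrite expr1 /k.
by field; rewrite a0 c0.
Qed.

(* Substituting x = (1/u - t.2) / t.1 sends the zero of the third form to infinity. *)
Lemma sum_kappa_triple (B : int) (p r t : F * F) :
    (forall d, `|binsum 1 d 1| <= B) ->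
    wedge p r != 0 -> wedge p t != 0 -> wedge r t != 0 ->
  `|\sum_x kappa (lin p x * lin r x * lin t x)| <= B + 2.
Proof.
move=> hB; have [t0|t0] := eqVneq t.1 0 => pr0 pt0 rt0.
  move: pt0 rt0; rewrite /wedge t0 !mulr0 !subr0 !mulf_eq0 => /norP[p0 tt0] /norP[r0 _].
  have := sum_kappa_two t.2 hB p0 r0 pr0.
  rewrite (eq_bigr (fun x => kappa (lin p x * lin r x * lin t x))) => [|x _].
    by move/le_trans; apply; rewrite lerDl.
  by rewrite [lin t x]/lin t0 mul0r add0r mulrC.
case: p r t t0 pr0 pt0 rt0 => [a b] [c d] [e f]; rewrite /wedge /= => e0 pr0 pt0 rt0.
set p' := (b * e - a * f, a); set r' := (d * e - c * f, c).
have p'0 : p'.1 != 0 by rewrite -oppr_eq0 opprB.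
have r'0 : r'.1 != 0 by rewrite -oppr_eq0 opprB.
have w0 : wedge p' r' != 0.
  have -> : wedge p' r' = - e * (a * d - b * c) by rewrite /wedge /=; ring.
  by rewrite mulf_neq0 ?oppr_eq0.
have h : injective (fun u => (u^-1 - f) / e).
  by move=> x y /(mulIf (invr_neq0 e0))/addIr/invr_inj.
rewrite (reindex_inj h) /= (bigD1 0) //=.
(* With 0^-1 = 0 the index u = 0 is sent to the root of the third form, so its term vanishes. *)
have -> : lin (e, f) ((0^-1 - f) / e) = 0 by rewrite /lin /= invr0; field.
rewrite mulr0 kappa0 add0r (eq_bigr (fun u => kappa (e * (lin p' u * lin r' u))))
  => [|u u0]; last first.
  have eu0 : e * u != 0 by rewrite mulf_neq0.
  rewrite -(kappaM3 _ eu0); congr kappa; rewrite /lin /=.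
  by field; rewrite e0 u0.
(* The transformed sum omits u = 0; putting that term back accounts for the extra 2. *)
have := sum_kappa_two e hB p'0 r'0 w0; rewrite (bigD1 0) //=.
have := kappa_le (e * (lin p' 0 * lin r' 0)).
suff arith (s k : int) : -1 <= k <= 2 -> `|k + s| <= B -> `|s| <= B + 2 by exact: arith.
lia.
Qed.

(** * The octahedron 0, oo, 1, -1, i, -i *)

Variable i : F.
Hypothesis i2 : i ^+ 2 = -1.
Hypothesis two0 : 2 != 0 :> F.

Definition vertices : seq (F * F) :=
  [:: (1, 0); (0, 1); (2, -2); (2, 2); (2, - (2 * i)); (2, 2 * i)].

Definition vertex (P : nat) : F * F := nth (0, 0) vertices P.

Definition oct (P : nat) (x : F) : F := lin (vertex P) x.

(** The determinants of the vertices and constants such as 1 + i all divide a power of 2, so they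
    are nonzero in odd characteristic. *)
Lemma neq0_of_dvd2 (c y : F) k : c * y = 2 ^+ k -> c != 0.
Proof.
move=> e; apply: contraTneq (expf_neq0 k two0) => c0.
by rewrite -e c0 mul0r eqxx.
Qed.

Lemma wedge_vertex (P Q : nat) : (P < 6)%N -> (Q < 6)%N -> P != Q ->
  wedge (vertex P) (vertex Q) != 0.
Proof.
have lt (P' Q' : nat) : (P' < Q')%N -> (Q' < 6)%N -> wedge (vertex P') (vertex Q') != 0.
  have e := i2; rewrite /vertex /wedge.
  case: P' => [|[|[|[|[|P']]]]]; case: Q' => [|[|[|[|[|[|Q']]]]]] PQ Q6; try lia;
    rewrite /= {PQ Q6}.
  - by apply: (@neq0_of_dvd2 _ 1 0); ring.
  - by apply: (@neq0_of_dvd2 _ (-1) 1); ring.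
  - by apply: (@neq0_of_dvd2 _ 1 1); ring.
  - by apply: (@neq0_of_dvd2 _ i 1); ring: e.
  - by apply: (@neq0_of_dvd2 _ (- i) 1); ring: e.
  - by apply: (@neq0_of_dvd2 _ (-1) 1); ring.
  - by apply: (@neq0_of_dvd2 _ (-1) 1); ring.
  - by apply: (@neq0_of_dvd2 _ (-1) 1); ring.
  - by apply: (@neq0_of_dvd2 _ (-1) 1); ring.
  - by apply: (@neq0_of_dvd2 _ 1 3); ring.
  - by apply: (@neq0_of_dvd2 _ (1 + i) 3); ring: e.
  - by apply: (@neq0_of_dvd2 _ (1 - i) 3); ring: e.
  - by apply: (@neq0_of_dvd2 _ (i - 1) 3); ring: e.
  - by apply: (@neq0_of_dvd2 _ (- (1 + i)) 3); ring: e.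
  - by apply: (@neq0_of_dvd2 _ (- i) 3); ring: e.
move=> P6 Q6; rewrite neq_ltn => /orP[PQ|QP]; first by apply: lt.
have -> : wedge (vertex P) (vertex Q) = - wedge (vertex Q) (vertex P).
  by rewrite /wedge; ring.
by rewrite oppr_eq0 lt.
Qed.

(** * The covering assumption read at each vertex *)

Lemma pent_root (a : F) : a ^+ 5 = a -> [|| a == 0, a == 1, a == -1, a == i | a == - i].
Proof.
move=> a5; have e := i2; have : a * ((a - 1) * ((a - -1) * ((a - i) * (a - - i)))) = 0.
  by transitivity (a ^+ 5 - a); [ring: e | rewrite a5 subrr].
by move/eqP; rewrite !mulf_eq0 !subr_eq0.
Qed.

(** The map (x + t) / (x - t) sends [t] to infinity and the other five vertices to the five possible
    [a]: -t to 0, infinity to 1, 0 to -1, and -jt to j. Subtracting [a] thus gives a constant times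
    a quotient of two vertex forms. *)
Lemma apex_matched (x t a : F) : t ^+ 4 = 1 -> x != t -> a ^+ 5 = a ->
  kappa ((x + t) / (x - t) - a) != -1 ->
  [\/ kappa (2 * (x + t) * (2 * (x - t)) ^+ 2) != -1,
      kappa (4 * (1 * (2 * (x - t)) ^+ 2)) != -1,
      kappa (4 * (x * (2 * (x - t)) ^+ 2)) != -1
    | exists2 j, (j == i) || (j == - i) &
        kappa (4 * (2 * (x + j * t) * (2 * (x - t)) ^+ 2)) != -1].
Proof.
move=> t4 xt a5; have xt0 : x - t != 0 by rewrite subr_eq0.
have one0 := oner_neq0 F.
have t0 : t != 0 by apply: contra_eq_neq t4 => ->; rewrite expr0n eq_sym.
have v0 : 2 * (x - t) != 0 by rewrite mulf_neq0.
have quarter (j : F) : j ^+ 2 = -1 -> a = j ->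
    kappa (4 * (2 * (x + j * t) * (2 * (x - t)) ^+ 2)) = kappa ((x + t) / (x - t) - a).
  move=> j2 ->; have j1 : 1 + j != 0 by apply: (@neq0_of_dvd2 _ (1 - j) 1); ring: j2.
  have j0 : j != 0.
    by apply: contra_eq_neq j2 => ->; rewrite expr0n eq_sym oppr_eq0.
  (* The numerator is (1 - j) (x + j t), and [(1 - j) * (2 * j * (1 + j)) ^+ 3 = 32], so this
     multiplier turns the constant into a power of 2. *)
  have vj0 : 2 * j * (1 + j) * (x - t) != 0 by rewrite !mulf_neq0.
  apply: (kappa_cubic_eq one0 vj0).
  transitivity ((x + t - j * (x - t)) * (2 * j * (1 + j)) ^+ 3 * (x - t) ^+ 2).
    ring: j2.
  by field.
case/or4P: (pent_root a5) => [/eqP ea|/eqP ea|/eqP ea|/orP[]/eqP ea].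
- rewrite -(kappa_cubic_eq one0 v0 (x := 2 * (x + t) * (2 * (x - t)) ^+ 2)); first by constructor 1.
  by rewrite ea; field.
- have vt0 : 2 * t * (x - t) != 0 by rewrite !mulf_neq0.
  rewrite -(kappa_cubic_eq one0 vt0 (x := 4 * (1 * (2 * (x - t)) ^+ 2))); first by constructor 2.
  transitivity (16 * t ^+ 4 * (x - t) ^+ 2); first by rewrite t4; ring.
  by rewrite ea; field.
- rewrite -(kappa_cubic_eq one0 v0 (x := 4 * (x * (2 * (x - t)) ^+ 2))); first by constructor 3.
  by rewrite ea; field.
- rewrite -(quarter i) //; constructor 4; exists i => //; by rewrite eqxx.
- rewrite -(quarter (- i)) ?sqrrN //; constructor 4; exists (- i) => //; by rewrite eqxx orbT.
Qed.

Lemma octE (x : F) :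
  [/\ oct 0 x = x, oct 1 x = 1 & oct 2 x = 2 * (x - 1)] /\
  [/\ oct 3 x = 2 * (x - -1), oct 4 x = 2 * (x - i) & oct 5 x = 2 * (x - - i)].
Proof. by rewrite /oct /lin /=; split; split; ring. Qed.

Lemma pent_root_neq (x : F) : x ^+ 5 != x ->
  [/\ x != 0, x != 1 & x != -1] /\ x != i /\ x != - i.
Proof.
have e := i2; move=> x5; split; [split|split]; apply: contraNneq x5 => ->; apply/eqP.
- by rewrite expr0n.
- by rewrite expr1n.
- by ring.
- by ring: e.
- by ring: e.
Qed.

Lemma oct_neq0 (x : F) (P : nat) : x ^+ 5 != x -> (P < 6)%N -> oct P x != 0.
Proof.
move=> /pent_root_neq[[x0 x1 xN1] [xi xNi]].
have [[o0 o1 o2] [o3 o4 o5]] := octE x.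
case: P => [|[|[|[|[|[|//]]]]]] _;
  by rewrite ?(o0, o1, o2, o3, o4, o5) ?oner_neq0 ?mulf_neq0 // subr_eq0.
Qed.

(** The assumption is applied to the image of [x] under a Moebius map taking [P] to infinity and its
    antipode to 0: 1/x, x, or (x + t) / (x - t). The choice a = 0 gives the antipode, the other four
    the neighbours. *)
Lemma octahedron_matched (x : F) (P : nat) :
    (forall y, exists2 a, a ^+ 5 = a & kappa (y - a) != -1) ->
    x ^+ 5 != x -> (P < 6)%N ->
  kappa (oct (antipode P) x * oct P x ^+ 2) != -1 \/
  exists Q, [/\ (Q < 6)%N, Q./2 != P./2 & kappa (4 * (oct Q x * oct P x ^+ 2)) != -1].
Proof.
move=> cover /pent_root_neq[[x0 x1 xN1] [xi xNi]].
have [[o0 o1 o2] [o3 o4 o5]] := octE x.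
have e := i2; have one0 := oner_neq0 F.
have i0 : i != 0 by apply: contra_eq_neq i2 => ->; rewrite expr0n eq_sym oppr_eq0.
case: P => [|[|[|[|[|[|//]]]]]] _; rewrite /antipode /= ?(o0, o1, o2, o3, o4, o5).
- have [a /pent_root + ka] := cover x^-1.
  have x20 : 2 * x != 0 by rewrite mulf_neq0.
  case/or4P => [/eqP ea|/eqP ea|/eqP ea|/orP[]/eqP ea]; [left|right..].
  + rewrite (kappa_cubic_eq one0 x0 (y := x^-1 - a)) // ea; by field.
  + exists 2%N; rewrite o2; split=> //.
    rewrite (kappa_cubic_eq one0 (_ : - (2 * x) != 0) (y := x^-1 - a)) ?oppr_eq0 // ea.
    by field.
  + exists 3%N; rewrite o3; split=> //.
    by rewrite (kappa_cubic_eq one0 x20 (y := x^-1 - a)) // ea; field.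
  + exists 5%N; rewrite o5; split=> //.
    have v0 : - (2 * i * x) != 0 by rewrite oppr_eq0 !mulf_neq0.
    rewrite (kappa_cubic_eq one0 v0 (y := x^-1 - a)) // ea.
    transitivity (- 8 * i ^+ 3 * x ^+ 2 * (1 - i * x)); last by field.
    by ring: e.
  + exists 4%N; rewrite o4; split=> //.
    have v0 : 2 * i * x != 0 by rewrite !mulf_neq0.
    rewrite (kappa_cubic_eq one0 v0 (y := x^-1 - a)) // ea.
    transitivity (8 * i ^+ 3 * x ^+ 2 * (1 + i * x)); last by field.
    by ring: e.
- have [a /pent_root + ka] := cover x.
  have ooE (t : F) : kappa (x - t) != -1 -> kappa (4 * (2 * (x - t) * 1 ^+ 2)) != -1.
    rewrite -(kappaM3 (x - t) two0); congr (is_true (kappa _ != _)); ring.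
  case/or4P => [/eqP ea|/eqP ea|/eqP ea|/orP[]/eqP ea]; [left|right..].
  + by move: ka; rewrite ea subr0 expr1n mulr1.
  + by exists 2%N; rewrite o2; split=> //; apply: ooE; rewrite -ea.
  + by exists 3%N; rewrite o3; split=> //; apply: ooE; rewrite -ea.
  + by exists 4%N; rewrite o4; split=> //; apply: ooE; rewrite -ea.
  + by exists 5%N; rewrite o5; split=> //; apply: ooE; rewrite -ea.
- have [a a5 ka] := cover ((x + 1) / (x - 1)).
  have t4 : 1 ^+ 4 = 1 :> F by rewrite expr1n.
  case: (apex_matched t4 x1 a5 ka) => [k|k|k|[j /orP[]/eqP-> k]]; [left|right..].
  + by rewrite opprK.
  + by exists 1%N; rewrite o1.
  + by exists 0%N; rewrite o0.
  + by exists 5%N; rewrite o5 opprK; split=> //; rewrite mulr1 in k.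
  + by exists 4%N; rewrite o4; split=> //; rewrite mulr1 in k.
- have [a a5 ka] := cover ((x + -1) / (x - -1)).
  have t4 : (-1) ^+ 4 = 1 :> F by ring.
  case: (apex_matched t4 xN1 a5 ka) => [k|k|k|[j /orP[]/eqP-> k]]; [left|right..].
  + by [].
  + by exists 1%N; rewrite o1.
  + by exists 0%N; rewrite o0.
  + by exists 4%N; rewrite o4; split=> //; rewrite mulrN1 in k.
  + by exists 5%N; rewrite o5; split=> //; rewrite mulrN1 in k.
- have [a a5 ka] := cover ((x + i) / (x - i)).
  have t4 : i ^+ 4 = 1 by ring: e.
  case: (apex_matched t4 xi a5 ka) => [k|k|k|[j /orP[]/eqP-> k]]; [left|right..].
  + by rewrite opprK.
  + by exists 1%N; rewrite o1.
  + by exists 0%N; rewrite o0.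
  + by exists 2%N; rewrite o2; split=> //; rewrite -expr2 e in k.
  + by exists 3%N; rewrite o3; split=> //; rewrite mulNr -expr2 e in k.
- have [a a5 ka] := cover ((x + - i) / (x - - i)).
  have t4 : (- i) ^+ 4 = 1 by ring: e.
  case: (apex_matched t4 xNi a5 ka) => [k|k|k|[j /orP[]/eqP-> k]]; [left|right..].
  + by [].
  + by exists 1%N; rewrite o1.
  + by exists 0%N; rewrite o0.
  + by exists 3%N; rewrite o3; split=> //; rewrite mulrN -expr2 e in k.
  + by exists 2%N; rewrite o2; split=> //; rewrite mulrNN -expr2 e in k.
Qed.

(** * Colourings by the exponents of the cubic symbols to a base [w] *)

Definition palette (w x : F) : seq nat :=
  [seq index (cubesym (oct P x)) [:: 1; w; w ^+ 2] | P <- iota 0 6].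

Definition pairsum (s : seq (nat * nat)) (x : F) : int :=
  \sum_(PQ <- s) kappa (oct PQ.1 x * oct PQ.2 x ^+ 2).

Definition fansum (x : F) : int :=
  \sum_(T <- fans) kappa (oct T.1.1 x * oct T.1.2 x * oct T.2 x).

Lemma sum_kappa_count (T : eqType) (s : seq T) (f : T -> F) (A : pred T) :
    {in s, forall p, kappa (f p) = 3 * (A p)%:Z - 1} ->
  \sum_(p <- s) kappa (f p) = 3 * (count A s)%:Z - (size s)%:Z.
Proof.
move=> fA; rewrite big_seq (eq_bigr _ fA) -big_seq sumrB -mulr_sumr.
rewrite -(@big_morph _ _ Posz _ _ _ _ PoszD (erefl _)) -sum1_count [in RHS]big_mkcond /=.
congr (3 * _%:Z - _).
by rewrite big_const_seq count_predT iter_addr addr0 natz.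
Qed.

Section Palette.

Variables (w x : F) (D : nat).
Hypothesis w3 : w ^+ 3 = 1.
Hypothesis w1 : w != 1.
Hypothesis two_w : cubesym 2 = w ^+ D.
Hypothesis x5 : x ^+ 5 != x.

Lemma dvd3_expr (n : nat) : (3 %| n)%N = (w ^+ n == 1).
Proof.
rewrite /dvdn -(expr_mod n w3); case: (n %% 3)%N (ltn_pmod n (isT : 0 < 3)%N) => [|[|[|//]]] _.
- by rewrite expr0 !eqxx.
- by rewrite expr1 (negPf w1).
- symmetry; apply/negbTE; apply: contra_neq w1 => w2.
  by rewrite -w3 exprS w2 mulr1.
Qed.

Lemma kappa_color (u : F) (n : nat) : u != 0 -> cubesym u = w ^+ n ->
  kappa u = 3 * (3 %| n)%N%:Z - 1.
Proof. by rewrite dvd3_expr /kappa => /negPf-> ->; case: eqP. Qed.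

Lemma nth_palette (P : nat) : (P < 6)%N ->
  nth 0%N (palette w x) P = index (cubesym (oct P x)) [:: 1; w; w ^+ 2].
Proof. by move=> P6; rewrite (nth_map 0%N) ?size_iota // nth_iota. Qed.

Lemma palette_le : all (fun c => c < 3)%N (palette w x).
Proof.
apply/allP => c /mapP[P]; rewrite mem_iota => /andP[_ P6] ->.
have := cube_root1 w3 w1 (cubesym_cube (oct_neq0 x5 P6)).
by rewrite -[3%N]/(size [:: 1; w; w ^+ 2]) index_mem !inE.
Qed.

Lemma cubesym_oct (P : nat) : (P < 6)%N ->
  cubesym (oct P x) = w ^+ nth 0%N (palette w x) P.
Proof.
move=> P6; rewrite nth_palette //.
have := cube_root1 w3 w1 (cubesym_cube (oct_neq0 x5 P6)).
set u := cubesym _ => hu; have uin : u \in [:: 1; w; w ^+ 2] by rewrite !inE.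
rewrite -[LHS](nth_index 0 uin); move: uin; rewrite -index_mem.
by case: (index u _) => [|[|[|]]].
Qed.

Lemma kappa_monochrome (PQ : nat * nat) : (PQ.1 < 6)%N && (PQ.2 < 6)%N ->
  kappa (oct PQ.1 x * oct PQ.2 x ^+ 2) = 3 * (monochrome (palette w x) PQ)%:Z - 1.
Proof.
move=> /andP[P6 Q6]; apply: kappa_color.
  by rewrite mulf_neq0 ?expf_neq0 // oct_neq0.
by rewrite cubesymM cubesymX !cubesym_oct // -exprM -exprD mulnC.
Qed.

Lemma kappa_null_fan (T : nat * nat * nat) :
    [&& T.1.1 < 6, T.1.2 < 6 & T.2 < 6]%N ->
  kappa (oct T.1.1 x * oct T.1.2 x * oct T.2 x) = 3 * (null_fan (palette w x) T)%:Z - 1.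
Proof.
move=> /and3P[P6 Q6 T6]; apply: kappa_color; first by rewrite !mulf_neq0 ?oct_neq0.
by rewrite !cubesymM !cubesym_oct // -!exprD.
Qed.

(** The six forms multiply to 16 x (x^4 - 1). A further factor 4 makes the constant 64, a cube, and
    contributes the colour [2 * D]. *)
Lemma kappa_total :
  kappa (x * (x ^+ 4 - 1)) = 3 * (3 %| sumn (palette w x) + 2 * D)%N%:Z - 1.
Proof.
have e := i2; have e16 : x * (x ^+ 4 - 1) * (2 ^+ 2) ^+ 3 =
    oct 0 x * (oct 1 x * (oct 2 x * (oct 3 x * (oct 4 x * oct 5 x)))) * 2 ^+ 2.
  have [[-> -> ->] [-> -> ->]] := octE x.
  by ring: e.
rewrite -(kappaM3 _ (expf_neq0 2 two0)) e16; apply: kappa_color.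
  by rewrite !mulf_neq0 ?expf_neq0 ?oct_neq0.
rewrite !cubesymM two_w !cubesym_oct // -!exprD.
by congr (w ^+ (_ + _)); [rewrite /= addn0 | rewrite mul2n addnn].
Qed.

Lemma palette_matched :
    (forall y, exists2 a, a ^+ 5 = a & kappa (y - a) != -1) ->
  all (matched D (palette w x)) (iota 0 6).
Proof.
move=> cover; apply/allP => P; rewrite mem_iota => /andP[_ P6]; apply/orP.
have kN (b : bool) : 3 * b%:Z - 1 != -1 -> b by case: b.
case: (octahedron_matched cover x5 P6) => [k|[Q [Q6 QP k]]]; [left|right].
  apply: kN; rewrite -kappa_monochrome //= P6 andbT.
  by move: P6; rewrite /antipode; case: P {k} => [|[|[|[|[|[|]]]]]].
apply/hasP; exists Q; rewrite ?mem_iota //= QP; apply: kN.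
rewrite -(kappa_color (u := 4 * (oct Q x * oct P x ^+ 2))) //.
  rewrite (_ : 4 = 2 ^+ 2); last by ring.
  by rewrite !mulf_neq0 ?expf_neq0 ?oct_neq0.
rewrite (_ : 4 = 2 ^+ 2); last by ring.
rewrite !cubesymM two_w !cubesym_oct // -!exprD.
by congr (w ^+ _); lia.
Qed.

Lemma pairsum_count (s : seq (nat * nat)) :
    all (fun PQ => (PQ.1 < 6) && (PQ.2 < 6))%N s ->
  pairsum s x = 3 * (count (monochrome (palette w x)) s)%:Z - (size s)%:Z.
Proof.
by move=> /allP s6; apply: sum_kappa_count => PQ /s6; exact: kappa_monochrome.
Qed.

Lemma fansum_count :
  fansum x = 3 * (count (null_fan (palette w x)) fans)%:Z - 12.
Proof.
have /allP f6 : all (fun T => [&& T.1.1 < 6, T.1.2 < 6 & T.2 < 6])%N fans by [].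
by rewrite /fansum (sum_kappa_count (A := null_fan (palette w x))) // => T /f6 /kappa_null_fan.
Qed.

End Palette.

Lemma octahedron_ineq1 (x : F) : cubesym 2 != 1 ->
    (forall y, exists2 a, a ^+ 5 = a & kappa (y - a) != -1) -> x ^+ 5 != x ->
  3 + pairsum edges x <=
    pairsum antip x + fansum x + 3 * kappa (x * (x ^+ 4 - 1)).
Proof.
move=> w1 cover x5; have w3 := cubesym_cube two0.
(* Taking the symbol of 2 itself as base gives 2 the colour 1, so colour 2 never has to be
   checked. *)
have two_w : cubesym 2 = cubesym 2 ^+ 1 by rewrite expr1.
have := matched1 _ (palette_le w3 w1 x5) (palette_matched w3 w1 two_w x5 cover).
rewrite (kappa_total w3 w1 two_w x5) (fansum_count w3 w1 x5).
rewrite !(pairsum_count w3 w1 x5) // size_map size_iota => /(_ erefl).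
rewrite muln1 [size edges]/= [size antip]/=.
by move: (nat_of_bool _) => b; lia.
Qed.

Lemma octahedron_ineq0 (x : F) : cubesym 2 = 1 ->
    (forall y, exists2 a, a ^+ 5 = a & kappa (y - a) != -1) -> x ^+ 5 != x ->
  2 <= pairsum edges x + pairsum antip x + 4 * kappa (x * (x ^+ 4 - 1)).
Proof.
move=> c2 cover x5; have [g g0 w1] := exists_noncube q1; have w3 := cubesym_cube g0.
have two_w : cubesym 2 = cubesym g ^+ 0 by rewrite expr0.
have := matched0 _ (palette_le w3 w1 x5) (palette_matched w3 w1 two_w x5 cover).
rewrite (kappa_total w3 w1 two_w x5).
rewrite !(pairsum_count w3 w1 x5) // size_map size_iota => /(_ erefl).
rewrite muln0 addn0 [size edges]/= [size antip]/=.
by move: (nat_of_bool _) => b; lia.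
Qed.

(** * Averaging the inequalities over the field *)

Lemma kappa_sum_range (T : Type) (s : seq T) (f : T -> F) :
  - (size s)%:Z <= \sum_(p <- s) kappa (f p) <= 2 * (size s)%:Z.
Proof.
elim: s => [|p s]; first by rewrite big_nil.
rewrite big_cons /=; suff arith (k t : int) (n : nat) : - n%:Z <= t <= 2 * n%:Z ->
    -1 <= k <= 2 -> - n.+1%:Z <= k + t <= 2 * n.+1%:Z.
  by move/arith; apply; exact: kappa_le.
lia.
Qed.

Lemma sum_pairsum_le (s : seq (nat * nat)) :
    all (fun PQ => [&& PQ.1 < 6, PQ.2 < 6 & PQ.1 != PQ.2])%N s ->
  `|\sum_x pairsum s x| <= 2 * (size s)%:Z.
Proof.
move=> /allP s6; rewrite exchange_big /=.
apply: le_trans (ler_norm_sum _ _ _) _; rewrite big_seq.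
apply: (@le_trans _ _ (\sum_(PQ <- s | PQ \in s) 2)).
  apply: ler_sum => PQ /s6/and3P[P6 Q6 PQn].
  by apply: sum_kappa_pair; apply: wedge_vertex.
by rewrite -big_seq big_const_seq count_predT iter_addr addr0 -[leLHS]mulr_natr (natz (size s)).
Qed.

Lemma sum_fansum_le (B : int) : (forall d, `|binsum 1 d 1| <= B) ->
  `|\sum_x fansum x| <= 12 * (B + 2).
Proof.
move=> hB; rewrite exchange_big /=.
apply: le_trans (ler_norm_sum _ _ _) _; rewrite big_seq.
apply: (@le_trans _ _ (\sum_(T <- fans | T \in fans) (B + 2))).
  have /allP f6 : all (fun T => [&& T.1.1 < 6, T.1.2 < 6, T.2 < 6,
      T.1.1 != T.1.2, T.1.1 != T.2 & T.1.2 != T.2])%N fans by [].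
  apply: ler_sum => T /f6/and5P[P6 Q6 T6 PQ /andP[PT QT]].
  by apply: sum_kappa_triple => //; apply: wedge_vertex.
by rewrite -big_seq big_const_seq iter_addr addr0 -[leLHS]mulr_natl.
Qed.

Lemma card_pent_roots : \sum_(x : F) (x ^+ 5 == x)%:Z <= 5.
Proof.
rewrite -(@big_morph _ _ Posz _ _ _ _ PoszD (erefl _)) lez_nat.
apply: leq_trans (card_size [:: 0; 1; -1; i; - i]).
rewrite -sum1_card [leqRHS]big_mkcond /=; apply: leq_sum => x _.
by case: eqP => // /pent_root; rewrite !inE => ->.
Qed.

Lemma exists_uncovered : (2809 < #|F|)%N ->
  ~ (forall y : F, exists2 a, a ^+ 5 = a & kappa (y - a) != -1).
Proof.
move=> q_large cover.
(* The bounds 96 q for r = 4 and 6 q for r = 1 become 2400 q after scaling by 5^2 and 20^2, and 2400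
   q is below q^2. *)
have sqr_le (c : nat) (s : int) : c%:Z ^+ 2 * s ^+ 2 <= 2400 * #|F|%:Z ->
    c%:Z * `|s| <= #|F|%:Z.
  move=> h; rewrite -ler_sqr ?nnegrE // exprMn real_normK ?num_real //.
  by apply: le_trans h _; rewrite expr2 ler_pM2r; lia.
have T_le : 5 * `|\sum_x kappa (x * (x ^+ 4 - 1))| <= #|F|%:Z.
  apply: (sqr_le 5%N); have := binsum_le 1 (isT : 0 < 4)%N.
  rewrite /binsum; under eq_bigr => x _ do rewrite mul1r.
  by move: (\sum_x _ : int) => T; lia.
have B_le (d : F) : `|binsum 1 d 1| <= (#|F| %/ 20)%N%:Z.
  have : 20 * `|binsum 1 d 1| <= #|F|%:Z.
    by apply: (sqr_le 20%N); have := binsum_le d (isT : 0 < 1)%N; lia.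
  lia.
have E_le : `|\sum_x pairsum edges x| <= 24 := @sum_pairsum_le edges isT.
have A_le : `|\sum_x pairsum antip x| <= 6 := @sum_pairsum_le antip isT.
have R_le := card_pent_roots.
have kT (x : F) := kappa_le (x * (x ^+ 4 - 1)).
have rE (x : F) : -12 <= pairsum edges x <= 24 := kappa_sum_range _ _.
have rA (x : F) : -3 <= pairsum antip x <= 6 := kappa_sum_range _ _.
have rf (x : F) : -12 <= fansum x <= 24 := kappa_sum_range _ _.
have sum_const (c : int) : \sum_(x : F) c = c * #|F|%:Z.
  by rewrite sumr_const -mulr_natr natz.
have [c2|c2] := eqVneq (cubesym 2) 1.
  (* At the at most five points with x^5 = x the trivial lower bound is -12 - 3 - 4 = -19; the
     correction 21 raises it to 2. *)
  have : \sum_(x : F) 2 <= \sum_x (pairsum edges x + pairsum antip x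
      + 4 * kappa (x * (x ^+ 4 - 1)) + 21 * (x ^+ 5 == x)%:Z).
    apply: ler_sum => x _; have [x5|x5] := eqVneq (x ^+ 5) x.
      have := kT x; have := rE x; have := rA x; rewrite mulr1.
      by move: (pairsum antip x) (pairsum edges x) (kappa _); lia.
    by rewrite mulr0 addr0; exact: octahedron_ineq0.
  rewrite sum_const !big_split /= -!mulr_sumr.
  suff arith (e a t r : int) (q : nat) : `|e| <= 24 -> `|a| <= 6 ->
      5 * `|t| <= q%:Z -> r <= 5 -> (2809 < q)%N ->
      2 * q%:Z <= e + a + 4 * t + 21 * r -> False.
    exact: arith E_le A_le T_le R_le q_large.
  lia.
have f_le := sum_fansum_le B_le.
(* The correction 45 closes the gap between the trivial bounds 3 + 24 on the left and -3 - 12 - 3 on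
   the right. *)
have : \sum_x (3 + pairsum edges x) <= \sum_x (pairsum antip x + fansum x
    + 3 * kappa (x * (x ^+ 4 - 1)) + 45 * (x ^+ 5 == x)%:Z).
  apply: ler_sum => x _; have [x5|x5] := eqVneq (x ^+ 5) x.
    have := kT x; have := rE x; have := rA x; have := rf x; rewrite mulr1.
    by move: (fansum x) (pairsum antip x) (pairsum edges x) (kappa _); lia.
  by rewrite mulr0 addr0; exact: octahedron_ineq1.
rewrite [leLHS]big_split /= sum_const !big_split /= -!mulr_sumr.
suff arith (e a f t r : int) (q : nat) : `|e| <= 24 -> `|a| <= 6 ->
    `|f| <= 12 * ((q %/ 20)%N%:Z + 2) -> 5 * `|t| <= q%:Z -> r <= 5 ->
    (2809 < q)%N -> 3 * q%:Z + e <= a + f + 3 * t + 45 * r -> False.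
  exact: arith E_le A_le f_le T_le R_le q_large.
lia.
Qed.

End CubicResidues.

(* F_q is any finite field F, q = #|F| (automatically a prime power). *)
Theorem theorem2p4 (F : finFieldType) :
  (#|F| %% 4 = 1)%N -> (3 %| #|F|.-1)%N -> (2809 < #|F|)%N ->
  let n := (1 + #|F|.-1 %/ 3)%N in
  exists c : F, ~ exists a b : F,
    [/\ a \in kpotents F 5, b \in kpotents F n & c = a + b].
Proof.
move=> q4 q3 q_large n.
have q1 : (1 < #|F|)%N by apply: leq_trans q_large.
have [g g0 g1] : exists2 g : F, g != 0 & g ^+ (#|F|.-1 %/ 2) != 1.
  by apply: exists_expf_neq1; lia.
(* By the choice of [g] the square of [i] is not 1, while its fourth power is, so [i] is a square
   root of -1. *)
pose i := g ^+ (#|F|.-1 %/ 4).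
have i2E : i ^+ 2 = g ^+ (#|F|.-1 %/ 2) by rewrite -exprM; congr (_ ^+ _); lia.
have i2 : i ^+ 2 = -1.
  have : (i ^+ 2) ^+ 2 == 1.
    by rewrite i2E -exprM (_ : (_ * _)%N = #|F|.-1) ?expf_pred //; lia.
  by rewrite sqrf_eq1 i2E (negPf g1) => /eqP.
have two0 : 2 != 0 :> F.
  apply: contraNneq g1 => h; rewrite -i2E i2 -subr_eq0 -opprD oppr_eq0.
  by rewrite -[1 + 1]/(2%:R) h.
case: (boolP [exists c : F, ~~ [exists a : F, [exists b : F,
    [&& a \in kpotents F 5, b \in kpotents F n & c == a + b]]]]).
  case/existsP => c /negP h; exists c => -[a [b [ha hb e]]]; apply: h.
  by apply/existsP; exists a; apply/existsP; exists b; rewrite ha hb e eqxx.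
rewrite negb_exists => /forallP cover; case: (exists_uncovered q3 q1 i2 two0 q_large).
move=> y; move: (cover y); rewrite negbK.
case/existsP => a /existsP[b /and3P[]]; rewrite !inE => /eqP ha /eqP hb /eqP->.
exists a => //; rewrite addrC addKr.
(* Cancelling a nonzero [b] in [b ^+ n = b] leaves [cubesym b = 1], so [kappa b] is 0 or 2. *)
have [->|b0] := eqVneq b 0; first by rewrite kappa0.
by rewrite kappa_cube //; apply: (mulfI b0); rewrite mulr1 -[RHS]hb -exprS.
Qed.
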